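(* Let $m,n \geq 2$ be integers, and write $m = 2q_1 + r_1$ and $n = 2q_2 + r_2$ with integers $q_1,q_2$ and $0\leq r_1,r_2\leq 1$. Then \[\gamma(H_{m,n}) \leq 8\left\lceil \frac{(m+r_1)(n+r_2)}{4} \right\rceil. \]
   Context: The infinite truncated square tiling graph $H_{\infty,\infty}$ has vertex set $\{(a,(x,y)) : a\in\mathbb{Z}_4,\ (x,y)\in\mathbb{Z}^2\}$. Its edges are: $(a,(x,y))\sim(a+1,(x,y))$ with $a+1$ taken modulo 4 (so each $(x,y)$ carries a 4-cycle whose vertices $0,1,2,3$ are its top, right, bottom, left vertices); $(1,(x,y))\sim(3,(x+1,y))$; and $(0,(x,y))\sim(2,(x,y+1))$. For $(x,y)\in\mathbb{Z}^2$ the octagon $O_{x,y}$ is the 8-cycle through $(0,(x,y)),(1,(x,y)),(3,(x+1,y)),(0,(x+1,y)),(2,(x+1,y+1)),(3,(x+1,y+1)),(1,(x,y+1)),(2,(x,y+1))$, in this cyclic order. For positive integers $m,n$, $H_{m,n}$ is the finite subgraph consisting of $m$ rows of $n$ octagons each: the union of the octagons $O_{x,y}$ with $0\le x\le n-1$, $0\le y\le m-1$. $\gamma(G)$ denotes the domination number of a finite graph $G$: the smallest cardinality of a set $T$ of vertices such that every vertex of $G$ is in $T$ or adjacent to a vertex of $T$. *)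

(* Defs.v *)
From mathcomp Require Import all_boot all_order all_algebra.

Set Implicit Arguments.
Unset Strict Implicit.
Unset Printing Implicit Defensive.

Import Order.TTheory GRing.Theory Num.Theory.

Section Domination.
Variables (T : finType) (e : rel T).

Definition dominating (D : {set T}) : bool :=
  [forall v, (v \in D) || [exists u in D, e u v]].

Lemma dominatingT : dominating [set: T].
Proof. by apply/forallP => v; rewrite inE. Qed.

Definition domination_number : nat :=
  #|[arg min_(D < [set: T] | dominating D) #|D|]|.

Lemma domination_numberP :
  (exists2 D, dominating D & #|D| = domination_number) /\
  (forall D, dominating D -> domination_number <= #|D|).
Proof.
rewrite /domination_number.
case: arg_minnP => [|D domD minD]; first exact: dominatingT.
by split; [exists D|].
Qed.

End Domination.

Local Open Scope ring_scope.

(* In the square at (x, y), 0, 1, 2, 3 are the top, right, bottom and left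
   vertices. *)
Definition vertex : Type := 'Z_4 * (int * int).

Definition Hinf_arc : rel vertex := fun u v =>
  [|| v == (u.1 + 1, u.2),
      (u.1 == 1) && (v == (3, (u.2.1 + 1, u.2.2)))
    | (u.1 == 0) && (v == (2, (u.2.1, u.2.2 + 1)))].

Definition Hinf_edge : rel vertex := fun u v => Hinf_arc u v || Hinf_arc v u.

Definition octagon (x y : int) : seq vertex :=
  [:: (0, (x, y)); (1, (x, y));
      (3, (x + 1, y)); (0, (x + 1, y));
      (2, (x + 1, y + 1)); (3, (x + 1, y + 1));
      (1, (x, y + 1)); (2, (x, y + 1))].

Lemma octagon_ucycle (x y : int) : ucycle Hinf_edge (octagon x y).
Proof.
have neq1 (z : int) : (z == z + 1) = false.
  by rewrite -{1}[z]addr0 (inj_eq (addrI z)).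
have neq1' (z : int) : (z + 1 == z) = false by rewrite eq_sym neq1.
apply/andP; split; last by rewrite /= !inE !xpair_eqE /= ?neq1 ?neq1' ?andbF.
by rewrite /= /Hinf_edge /Hinf_arc !xpair_eqE /= !eqxx ?neq1 ?neq1' ?orbT.
Qed.

(* m rows (indexed by y) of n octagons each (indexed by x). *)
Definition octagons (m n : nat) : seq (seq vertex) :=
  [seq octagon x%:Z y%:Z | y <- iota 0 m, x <- iota 0 n].

Definition Hvertex (m n : nat) : finType := seq_sub (flatten (octagons m n)).

(* [next] and [prev] are the two neighbours of a vertex along a cycle; the
   membership guard is needed because they are the identity off the cycle. *)
Definition cycle_edge (c : seq vertex) : rel vertex := fun u v =>
  (u \in c) && ((v == next c u) || (v == prev c u)).

Definition Hedge (m n : nat) : rel (Hvertex m n) := fun u v =>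
  has (fun c => cycle_edge c (val u) (val v)) (octagons m n).

Definition gammaH (m n : nat) : nat := domination_number (@Hedge m n).

Lemma cycle_edge_sym (c : seq vertex) : uniq c -> symmetric (cycle_edge c).
Proof.
move=> Uc; have impl u v : cycle_edge c u v -> cycle_edge c v u.
  case/andP=> cu /orP[] /eqP->; rewrite /cycle_edge.
    by rewrite mem_next cu prev_next ?eqxx ?orbT.
  by rewrite mem_prev cu next_prev ?eqxx.
by move=> u v; apply/idP/idP; apply: impl.
Qed.

Lemma Hedge_sym (m n : nat) : symmetric (@Hedge m n).
Proof.
move=> u v; apply: eq_in_has => c /allpairsP[[y x] [_ _ ->]].
by apply: cycle_edge_sym; case/andP: (octagon_ucycle x y).
Qed.

Lemma Hedge_Hinf (m n : nat) (u v : Hvertex m n) :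
  Hedge u v -> Hinf_edge (val u) (val v).
Proof.
case/hasP=> c /allpairsP[[y x] [_ _ ->]] /andP[cu].
case/andP: (octagon_ucycle x y) => Ec _ /orP[] /eqP->; first exact: next_cycle.
by rewrite /Hinf_edge orbC; apply: (prev_cycle Ec cu).
Qed.

(* Main.v *)
Require Import Defs.
From mathcomp Require Import all_boot all_order all_algebra.

(** Cut the rows and the columns of octagons into consecutive pairs, the last
    pair being incomplete when their number is odd.  This cuts the octagons
    into (m + r1) / 2 * ((n + r2) / 2) blocks of size at most 2 x 2, so it
    suffices to spend eight vertices per block.  In a full block the square in
    the middle is a 4-cycle, and the other twenty vertices form a cycle to
    which it is joined by four edges.  The top and bottom vertices of the
    middle square dominate this square and two opposite vertices of the outer
    cycle; what remains of the outer cycle is two paths of nine vertices, each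
    dominated by three of its vertices.  These are the eight vertices of
    [block].

    The set so obtained has a stronger property: each octagon is dominated,
    along its own edges, by three of the chosen vertices that it contains
    ([octagon_code_dominates], [octagon_code_block]).  Hence incomplete blocks
    need no separate treatment: the chosen vertices that fall outside the
    finite graph can be thrown away, because every vertex of the graph is
    dominated inside an octagon of the graph. *)

Set Implicit Arguments.
Unset Strict Implicit.
Unset Printing Implicit Defensive.

Import Order.TTheory GRing.Theory Num.Theory.
Local Open Scope ring_scope.

Lemma domination_number_le (T : finType) (e : rel T) (D : {set T}) :
  dominating e D -> (domination_number e <= #|D|)%N.
Proof. by case: (domination_numberP e) => _; apply. Qed.

Lemma next_nth_mod (T : eqType) (x0 : T) (c : seq T) (i : nat) :
  uniq c -> (i < size c)%N ->
  next c (nth x0 c i) = nth x0 c (i.+1 %% size c)%N.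
Proof.
move=> Uc lt_i; rewrite next_nth mem_nth // index_uniq //.
case: c Uc lt_i => // y s _ lt_i.
have [lt_is | ge_is] := ltnP i (size s).
  by rewrite /= modn_small //=; apply: set_nth_default.
have -> : i = size s by apply/eqP; rewrite eqn_leq ge_is -ltnS lt_i.
by rewrite /= modnn nth_default.
Qed.

Lemma cycle_edge_nth (c : seq vertex) (v0 : vertex) (i j : nat) :
  uniq c -> (i < size c)%N -> (j < size c)%N ->
  (j == i.+1 %% size c)%N || (i == j.+1 %% size c)%N ->
  cycle_edge c (nth v0 c i) (nth v0 c j).
Proof.
move=> Uc lt_i lt_j /orP[]/eqP e; last rewrite cycle_edge_sym //;
  by rewrite /cycle_edge mem_nth // next_nth_mod // -e eqxx.
Qed.

(** Lower left corner at (a, b): the right vertices of the left column of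
    squares, the left vertices of the right column, and the top and bottom
    vertices of the middle square. *)
Definition block (a b : int) : seq vertex :=
  [:: (1, (a, b)); (1, (a, b + 1)); (1, (a, b + 1 + 1));
      (3, (a + 1 + 1, b)); (3, (a + 1 + 1, b + 1)); (3, (a + 1 + 1, b + 1 + 1));
      (0, (a + 1, b + 1)); (2, (a + 1, b + 1))].

(** Positions, along the octagon in column [ex] and row [ey] of a block, of
    the vertices that it shares with [block]. *)
Definition octagon_code (ex ey : bool) : seq nat :=
  match ex, ey with
  | false, false => [:: 1; 4; 6]
  | true,  false => [:: 2; 5; 7]
  | false, true  => [:: 1; 3; 6]
  | true,  true  => [:: 0; 2; 5]
  end%N.

Lemma octagon_code_dominates (ex ey : bool) (j : nat) : (j < 8)%N ->
  exists2 i, (i \in octagon_code ex ey) && (i < 8)%N &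
    (i == j) || ((j == i.+1 %% 8) || (i == j.+1 %% 8))%N.
Proof.
move=> lt_j.
suff /hasP[i code_i dom_i] :
    has (fun i => (i < 8) && ((i == j) || ((j == i.+1 %% 8) || (i == j.+1 %% 8))))%N
        (octagon_code ex ey).
  by case/andP: dom_i => lt_i dom_i; exists i; rewrite ?code_i.
by case: ex; case: ey; do 8![case: j lt_j => [//|j lt_j]].
Qed.

Lemma octagon_code_block (v0 : vertex) (a b : int) (ex ey : bool) (i : nat) :
  i \in octagon_code ex ey ->
  nth v0 (octagon (a + ex%:Z) (b + ey%:Z)) i \in block a b.
Proof.
by case: ex; case: ey; rewrite /octagon_code !inE => /or3P[]/eqP->;
  rewrite /block /= ?addr0 eqxx ?orbT.
Qed.

(** Asking for an edge of the octagon itself, not just of the block, is what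
    keeps the dominating vertex and the edge that it uses inside any union of
    octagons that contains this one. *)
Lemma octagon_dominated (a b : int) (ex ey : bool) (v : vertex) :
  let c := octagon (a + ex%:Z) (b + ey%:Z) in
  v \in c ->
  exists2 u, (u \in c) && (u \in block a b) & (u == v) || cycle_edge c u v.
Proof.
move=> c cv; have Uc : uniq c by case/andP: (octagon_ucycle (a + ex%:Z) (b + ey%:Z)).
have lt_j : (index v c < 8)%N by rewrite -index_mem in cv.
have [i /andP[code_i lt_i] adj_ij] := octagon_code_dominates ex ey lt_j.
exists (nth v c i); first by rewrite mem_nth // octagon_code_block.
rewrite -{2 4}(nth_index v cv).
case/orP: adj_ij => [/eqP->|adj_ij]; first by rewrite eqxx.
by rewrite cycle_edge_nth ?orbT.
Qed.

Definition blocks (p q : nat) : seq vertex :=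
  flatten [seq block (i.*2)%:Z (j.*2)%:Z | j <- iota 0 p, i <- iota 0 q].

Lemma size_blocks (p q : nat) : size (blocks p q) = (8 * (p * q))%N.
Proof.
rewrite size_flatten /shape.
set ss := (X in map size X).
have /all_pred1P -> : all (pred1 8) (map size ss).
  by rewrite all_map; apply/allP=> _ /allpairsP[[j i] [_ _ ->]].
by rewrite size_map sumn_nseq size_allpairs !size_iota.
Qed.

Definition blocks_set (m n p q : nat) : {set Hvertex m n} :=
  [set v | val v \in blocks p q].

Lemma card_blocks_set (m n p q : nat) :
  (#|blocks_set m n p q| <= 8 * (p * q))%N.
Proof.
rewrite -size_blocks cardE -(size_map val); apply: uniq_leq_size.
  by rewrite map_inj_uniq ?enum_uniq //; apply: val_inj.
by move=> _ /mapP[v Dv ->]; move: Dv; rewrite mem_enum inE.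
Qed.

Lemma blocks_set_dominating (m n p q : nat) :
  (m <= p.*2)%N -> (n <= q.*2)%N ->
  dominating (@Hedge m n) (blocks_set m n p q).
Proof.
move=> le_mp le_nq; apply/forallP=> v.
have /flattenP[_ /allpairsP[[y x] /= [ltym ltxn ->]] cv] := valP v.
rewrite !mem_iota /= !add0n in ltym ltxn.
have split_half (z : nat) : z%:Z = (z./2.*2)%:Z + (odd z : nat)%:Z.
  by rewrite -PoszD addnC odd_double_half.
have := cv; rewrite (split_half x) (split_half y).
case/octagon_dominated=> u; rewrite -(split_half x) -(split_half y).
move=> /andP[cu blk_u] adj_uv.
have oct_in : octagon x y \in octagons m n.
  by apply/allpairsP; exists (y, x); rewrite !mem_iota.
have Hu : u \in flatten (octagons m n) by apply/flattenP; exists (octagon x y).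
have half_lt (z t r : nat) : (z < t -> t <= r.*2 -> z./2 < r)%N.
  by move=> lt_zt le_tr; rewrite ltn_half_double (leq_trans lt_zt).
have Du : SeqSub Hu \in blocks_set m n p q.
  rewrite inE; apply/flattenP; exists (block (x./2.*2)%:Z (y./2.*2)%:Z) => //.
  apply/allpairsP; exists (y./2, x./2); rewrite !mem_iota /= !add0n.
  by rewrite (half_lt y m p) // (half_lt x n q).
case/orP: adj_uv => [/eqP uv | adj_uv].
  by rewrite -[v](val_inj (uv : val (SeqSub Hu) = val v)) Du.
apply/orP; right; apply/existsP; exists (SeqSub Hu); rewrite Du /=.
by apply/hasP; exists (octagon x y).
Qed.

Lemma gammaH_le_blocks (m n p q : nat) :
  (m <= p.*2)%N -> (n <= q.*2)%N -> (gammaH m n <= 8 * (p * q))%N.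
Proof.
move=> le_mp le_nq; apply: leq_trans (card_blocks_set m n p q).
exact/domination_number_le/blocks_set_dominating.
Qed.

Theorem theorem2p7 (m n q1 q2 r1 r2 : nat)
    (hm : (2 <= m)%N) (hn : (2 <= n)%N)
    (hmq : m = (2 * q1 + r1)%N) (hnq : n = (2 * q2 + r2)%N)
    (hr1 : (r1 <= 1)%N) (hr2 : (r2 <= 1)%N) :
  ((gammaH m n)%:Z <=
     8 * Num.ceil (((m + r1) * (n + r2))%N%:R / 4%:R : rat))%R.
Proof.
have rounded (k z r : nat) : k = (2 * z + r)%N -> (k + r = (z + r).*2)%N.
  by move=> ->; rewrite -addnA addnn doubleD mul2n.
have mE := rounded _ _ _ hmq; have nE := rounded _ _ _ hnq.
have -> : ((m + r1) * (n + r2))%N%:R / 4%:R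
            = (((q1 + r1) * (q2 + r2))%N%:Z)%:~R :> rat.
  rewrite mE nE -!mul2n mulnACA natrM mulrAC divff ?mul1r //.
rewrite intrKceil -[8]/(8%N%:Z) -PoszM lez_nat.
by apply: gammaH_le_blocks; rewrite -?mE -?nE leq_addr.
Qed.
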